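(* For every positive integer $d$, every finite nonempty pattern $P\subset\mathbb{R}^d$ with $|P|=k$, all real numbers $c,\delta>0$, and every real $\varepsilon$ with $0<\varepsilon\leq 1/3$, there exists a positive number $Z_0=Z_0(d,P,c,\delta,\varepsilon)$ with the following property: if $S$ is a $\delta$-separated point set in the $d$-dimensional cube $[0,L]^d$, with at least $cL^d$ points, where $L\geq Z_0$, then $S$ contains a subset that is an $\varepsilon$-approximate homothetic copy of $P$.
   Context: Let $\delta>0$. A point set $S\subset\mathbb{R}^d$ is $\delta$-separated if any two distinct points of $S$ are at Euclidean distance at least $\delta$. A pattern is a finite point set. A set $Q'$ is homothetic to a finite pattern $P\subset\mathbb{R}^d$ if $Q'=\lambda P+v$ for some $\lambda>0$ and $v\in\mathbb{R}^d$ (scaling and translation, no rotation). For $0<\varepsilon\leq 1/3$ and point sets $P,Q$ in $\mathbb{R}^d$ with $|P|=|Q|=k$, $Q$ is an $\varepsilon$-approximate homothetic copy of $P$ if there exist a set $Q'=\{q'_1,\ldots,q'_k\}$ homothetic to $P$ and a labeling $Q=\{q_1,\ldots,q_k\}$ by distinct points such that, for each $i$, $q_i$ lies in the closed ball of radius $\varepsilon m$ centered at $q'_i$, where $m$ is the minimum pairwise distance among points of $Q'$. (For $k=1$, any one-point set counts as an $\varepsilon$-approximate homothetic copy of a one-point pattern.) *)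

(* Defs.v *)
From mathcomp Require Import all_boot all_order all_algebra finmap.
From mathcomp Require Import boolp classical_sets functions cardinality reals.

Set Implicit Arguments.
Unset Strict Implicit.
Unset Printing Implicit Defensive.

Import Order.TTheory GRing.Theory Num.Theory.

Local Open Scope ring_scope.
Local Open Scope classical_set_scope.

(* MathComp-Analysis norms row vectors by the sup norm, hence an explicit
   Euclidean distance. *)
Definition edist (R : realType) (d : nat) (x y : 'rV[R]_d) : R :=
  Num.sqrt (\sum_(i < d) (x ord0 i - y ord0 i) ^+ 2).

Definition separated (R : realType) (d : nat) (delta : R)
    (S : set 'rV[R]_d) : Prop :=
  forall x y, S x -> S y -> x <> y -> delta <= edist x y.

Definition cube (R : realType) (d : nat) (L : R) : set 'rV[R]_d :=
  [set x | forall i : 'I_d, 0 <= x ord0 i <= L].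

(* [S] has at least [t] points, for a real [t]; [S] may be infinite. *)
Definition has_at_least (R : realType) (T : Type) (S : set T) (t : R) : Prop :=
  exists2 n : nat, t <= n%:R & (`I_n #<= S)%card.

Definition homothetic (R : realType) (d : nat)
    (P Q' : {fset 'rV[R]_d}) : Prop :=
  exists (lambda : R) (v : 'rV[R]_d),
    0 < lambda /\ Q' = [fset (lambda *: p + v)%R | p in P]%fset.

(* There is no such [m] when [Q] has fewer than two points. *)
Definition is_min_dist (R : realType) (d : nat)
    (Q : {fset 'rV[R]_d}) (m : R) : Prop :=
  (exists x y, [/\ x \in Q, y \in Q, x <> y & edist x y = m]) /\
  (forall x y, x \in Q -> y \in Q -> x <> y -> m <= edist x y).

Definition labeling (T : choiceType) (k : nat) (Q : {fset T})
    (q : 'I_k -> T) : Prop :=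
  injective q /\ Q = [fset q i | i in 'I_k]%fset.

(* The first disjunct is the convention for one-point patterns, where the
   minimum pairwise distance is undefined. *)
Definition approx_homothetic_copy (R : realType) (d : nat) (eps : R)
    (P Q : {fset 'rV[R]_d}) : Prop :=
  #|` Q| = #|` P| /\
  (#|` P| = 1%N \/
   exists (Q' : {fset 'rV[R]_d}) (m : R) (q' q : 'I_(#|` P|) -> 'rV[R]_d),
     [/\ homothetic P Q', is_min_dist Q' m, labeling Q' q', labeling Q q &
         forall i, edist (q i) (q' i) <= eps * m]).

(* Main.v *)
Require Import Defs.
From mathcomp Require Import all_boot all_order all_algebra finmap.
From mathcomp Require Import boolp classical_sets functions cardinality reals.
From mathcomp Require Import zify ring lra.

(** Fix M so large that in a cube of side M*s, cut into M^d cells of side s, a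
    scaled copy of P fits whose minimum distance m satisfies
    sqrt d * s < eps * m.  If every cell met S, moving each point of the copy
    to a point of S in its cell would give an approximate copy of P.  So if S
    contains no such copy, then at every scale at least one cell is empty, and
    by induction on j a cube of side M^j * s0, where s0 is below the separation
    scale, contains at most (M^d - 1)^j points of S: a vanishing proportion of
    its volume. *)

Set Implicit Arguments.
Unset Strict Implicit.
Unset Printing Implicit Defensive.

Import Order.TTheory GRing.Theory Num.Theory.

Local Open Scope ring_scope.
Local Open Scope classical_set_scope.

(** Half-open above, so that rounding coordinates down inside a cell of side [M.+1 * s] never yields
    the out-of-range index [M.+1]. *)
Definition cell (R : realType) (d : nat) (a : 'rV[R]_d) (s : R) :
    set 'rV[R]_d :=
  [set x | forall i, a ord0 i <= x ord0 i < a ord0 i + s].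

Definition subcorner (R : realType) (d M : nat) (a : 'rV[R]_d) (s : R)
    (k : {ffun 'I_d -> 'I_M}) : 'rV[R]_d :=
  \row_i (a ord0 i + s * (k i)%:R).

(** Meaningful only for [x] in the cell of side [M.+1 * s] at [a]; elsewhere [Num.truncn] and
    [inord] may return default values. *)
Definition subindex (R : realType) (d M : nat) (a : 'rV[R]_d) (s : R)
    (x : 'rV[R]_d) : {ffun 'I_d -> 'I_M.+1} :=
  [ffun i => inord (Num.truncn ((x ord0 i - a ord0 i) / s))].

Lemma cell_subindex (R : realType) (d M : nat) (a : 'rV[R]_d) (s : R) x :
  0 < s -> cell a (M.+1%:R * s) x ->
  cell (subcorner a s (subindex M a s x)) s x.
Proof.
move=> s0 ax i; have /andP[ai xi] := ax i; rewrite !mxE ffunE.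
set t := _ / s.
have t0 : 0 <= t by rewrite divr_ge0 ?subr_ge0 // ltW.
have tM : t < M.+1%:R by rewrite ltr_pdivrMr // ltrBlDl.
have ts : t * s = x ord0 i - a ord0 i by rewrite divfK // gt_eqF.
have /andP[lt1 lt2] := truncn_itv t0.
rewrite inordK; last by rewrite -(ltr_nat R); apply: le_lt_trans tM.
move: lt1 lt2; rewrite -(ler_pM2r s0) -(ltr_pM2r s0) ts -natr1.
by move=> h1 h2; apply/andP; split; lra.
Qed.

Lemma edist_le_sup (R : realType) (d : nat) (s : R) (x y : 'rV[R]_d) :
  0 <= s -> (forall i, `|x ord0 i - y ord0 i| <= s) ->
  edist x y <= Num.sqrt d%:R * s.
Proof.
move=> s0 xys; rewrite -[s in leRHS]ger0_norm// -sqrtr_sqr.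
rewrite -sqrtrM ?ler0n// ler_sqrt ?mulr_ge0 ?sqr_ge0 ?ler0n//.
rewrite mulr_natl -[X in _ *+ X](card_ord d) -sumr_const; apply: ler_sum => i _.
by rewrite -[leLHS]real_normK ?num_real// ler_sqr ?nnegrE.
Qed.

Lemma cell_dist (R : realType) (d : nat) (a : 'rV[R]_d) (s : R) x y :
  cell a s x -> cell a s y -> forall i, `|x ord0 i - y ord0 i| <= s.
Proof.
move=> ax ay i; have /andP[? ?] := ax i; have /andP[? ?] := ay i.
by rewrite ler_norml; apply/andP; split; lra.
Qed.

Lemma edist_gt0 (R : realType) (d : nat) (x y : 'rV[R]_d) :
  x <> y -> 0 < edist x y.
Proof.
move=> xy; rewrite sqrtr_gt0 lt_neqAle sumr_ge0 ?andbT => [|i _]; last first.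
  exact: sqr_ge0.
rewrite eq_sym; apply/eqP => /psumr_eq0P h; apply: xy.
apply/rowP => i; apply/eqP; rewrite -subr_eq0 -sqrf_eq0.
by rewrite h// => j _; apply: sqr_ge0.
Qed.

Lemma edist_homothety (R : realType) (d : nat) (l : R) (v x y : 'rV[R]_d) :
  0 < l -> edist (l *: x + v) (l *: y + v) = l * edist x y.
Proof.
move=> /ltW l0; rewrite /edist -[l in RHS]ger0_norm// -sqrtr_sqr.
rewrite -sqrtrM ?sqr_ge0// mulr_sumr; congr Num.sqrt; apply: eq_bigr => i _.
by rewrite !mxE; ring.
Qed.

Lemma min_dist_exists (R : realType) (d : nat) (P : {fset 'rV[R]_d}) :
  (1 < #|` P|)%N -> exists2 m, 0 < m & is_min_dist P m.
Proof.
move=> P1.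
have s0 : (0 < #|` P|)%N by apply: leq_trans P1.
pose p (i : 'I_#|` P|) := nth 0 P i.
have pI : injective p.
  by move=> i j /eqP; rewrite nth_uniq ?fset_uniq ?ltn_ord// => /eqP/val_inj.
have pP i : p i \in P by rewrite mem_nth.
pose T := ('I_#|` P| * 'I_#|` P|)%type.
pose C (u : T) := u.1 != u.2.
(* Two points in [P] give a pair of distinct indices, so the minimum below is over a nonempty
   set. *)
have Ci0 : C (Ordinal s0, Ordinal P1) by [].
pose D (u : T) := edist (p u.1) (p u.2).
case: (arg_minP D Ci0) => -[i j] /= ij minij.
exists (D (i, j)).
  by apply: edist_gt0 => /pI/eqP; apply/negP.
split.
  exists (p i), (p j); split=> //.
  by move=> /pI/eqP; apply/negP.
move=> x y xP yP xy.
have xs : (index x P < #|` P|)%N by rewrite index_mem.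
have ys : (index y P < #|` P|)%N by rewrite index_mem.
have := minij (Ordinal xs, Ordinal ys).
rewrite /D /C /p /= !nth_index//; apply.
apply/negP => /eqP [] /(congr1 (nth 0 P)).
by rewrite !nth_index.
Qed.

Lemma min_dist_homothety (R : realType) (d : nat) (P : {fset 'rV[R]_d})
    (l m : R) (v : 'rV[R]_d) :
  0 < l -> is_min_dist P m ->
  is_min_dist [fset (l *: p + v)%R | p in P]%fset (l * m).
Proof.
move=> l0 [[x [y [xP yP xy <-]]] minm]; split.
  exists (l *: x + v), (l *: y + v); split.
  - exact: in_imfset.
  - exact: in_imfset.
  - by move=> /addIr/(scalerI (lt0r_neq0 l0)).
  - exact: edist_homothety.
move=> _ _ /imfsetP[/= u uP ->] /imfsetP[/= w wP ->] uw.
by rewrite edist_homothety// ler_pM2l//; apply: minm => // e; rewrite e in uw.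
Qed.

(** The copy is scaled in proportion to [s], so one [M], chosen before [S], [a] and [s], serves
    every scale; the induction on scales rests on this uniformity. *)
Lemma copy_in_full_grid (R : realType) (d : nat) (P : {fset 'rV[R]_d})
    (eps : R) : (1 < #|` P|)%N -> 0 < eps <= 1 / 3%:R ->
  exists2 M : nat, (0 < M)%N &
  forall (S : set 'rV[R]_d) (a : 'rV[R]_d) (s : R), 0 < s ->
    (forall k : {ffun 'I_d -> 'I_M.+1},
       exists2 x, S x & cell (subcorner a s k) s x) ->
    exists Q : {fset 'rV[R]_d},
      [set` Q] `<=` S /\ approx_homothetic_copy eps P Q.
Proof.
move=> P1 /andP[eps0 eps3].
have [m0 m0_gt0 minP] := min_dist_exists P1.
have [B B0 PB] : exists2 B : R, 0 <= B &
    forall p i, p \in P -> `|p ord0 i| <= B.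
  exists (\sum_(p <- P) \sum_i `|p ord0 i|).
    by apply: sumr_ge0 => p _; apply: sumr_ge0.
  move=> p i pP; rewrite (big_rem p)//= (bigD1 i)//= -addrA lerDl.
  by rewrite addr_ge0// ?sumr_ge0// => q _; apply: sumr_ge0.
(* With scale [l = mu * s], the tolerance [eps * (l * m0)] equals [(sqrt d + 1) * s], which exceeds
   the bound [sqrt d * s] on distances within a cell. *)
pose mu := (Num.sqrt d%:R + 1) / (eps * m0).
have em0 : 0 < eps * m0 by rewrite mulr_gt0.
have mu0 : 0 < mu by rewrite divr_gt0// ltr_wpDl// sqrtr_ge0.
(* The scaled pattern spans at most [2 * l * B = 2 * mu * B * s < M * s] in each coordinate; the
   shift [v] moves it to start at or above the corner [a]. *)
pose M := (Num.truncn (2 * mu * B)).+1.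
have MB : 2 * mu * B < M%:R by apply: truncnS_gt.
exists M => // S a s s0 full.
pose l := mu * s; have l0 : 0 < l by rewrite mulr_gt0.
pose v : 'rV[R]_d := \row_i (a ord0 i + l * B).
pose h (p : 'rV[R]_d) := l *: p + v.
have hcell p : p \in P -> cell a (M.+1%:R * s) (h p).
  move=> pP i; have := PB p i pP; rewrite ler_norml => /andP[b1 b2].
  rewrite !mxE.
  have : l * - B <= l * p ord0 i by rewrite ler_pM2l.
  have : l * p ord0 i <= l * B by rewrite ler_pM2l.
  have : 2 * mu * B * s < M%:R * s by rewrite ltr_pM2r.
  rewrite /l -natr1; move: (mu * s * p ord0 i) => t ? ? ?.
  by apply/andP; split; nra.
pose k p := subindex M a s (h p).
have [g gS gcell] : exists2 g : {ffun 'I_d -> 'I_M.+1} -> 'rV[R]_d,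
    forall k, S (g k) & forall k, cell (subcorner a s k) s (g k).
  have /choice[g gP] : forall k : {ffun 'I_d -> 'I_M.+1}, exists x,
      S x /\ cell (subcorner a s k) s x.
    by move=> k'; have [x ? ?] := full k'; exists x.
  by exists g => k'; case: (gP k').
have hk p : p \in P -> cell (subcorner a s (k p)) s (h p).
  by move=> pP; apply: cell_subindex => //; apply: hcell.
have small : Num.sqrt d%:R * s < eps * (l * m0).
  have -> : eps * (l * m0) = (Num.sqrt d%:R + 1) * s.
    rewrite /l /mu; field; rewrite ?gt_eqF//.
  by rewrite ltr_pM2r// ltrDl.
have lm0 : 0 < l * m0 by rewrite mulr_gt0.
have eps1 : 3%:R * (eps * (l * m0)) <= l * m0.
  by rewrite mulrA ler_piMl ?(ltW lm0)//; lra.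
have [_ minQ] := min_dist_homothety v l0 minP.
have hI : injective h.
  by move=> x y /addIr/(scalerI (lt0r_neq0 l0)).
have near p i : p \in P -> `|g (k p) ord0 i - h p ord0 i| <= s.
  by move=> pP; apply: cell_dist (gcell _) (hk _ pP) i.
(* Here [eps <= 1/3] enters: if two pattern points selected the same point of [S], their images
   would be within [2 * sqrt d * s < 2 * eps * l * m0 < l * m0], below the minimum distance. *)
have kI p q : p \in P -> q \in P -> g (k p) = g (k q) -> p = q.
  move=> pP qP e; apply: contrapT => pq.
  have : l * m0 <= edist (h p) (h q).
    by apply: minQ; [exact: in_imfset | exact: in_imfset | move=> /hI].
  have : edist (h p) (h q) <= Num.sqrt d%:R * (s + s).
    apply: edist_le_sup => [|i]; first by lra.
    apply: le_trans (ler_distD (g (k p) ord0 i) _ _) _.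
    by apply: lerD; [rewrite distrC; exact: near | rewrite e; exact: near].
  by rewrite mulrDr; move: (l * m0) small eps1 lm0 => z; lra.
pose p (i : 'I_#|` P|) := nth 0 P i.
have pI : injective p.
  by move=> i j /eqP; rewrite nth_uniq ?fset_uniq ?ltn_ord// => /eqP/val_inj.
have pP i : p i \in P by rewrite mem_nth.
have Pp x : x \in P -> exists i, x = p i.
  move=> xP; have xs : (index x P < #|` P|)%N by rewrite index_mem.
  by exists (Ordinal xs); rewrite /p nth_index.
pose q i := g (k (p i)).
have qI : injective q by move=> i j /(kI _ _ (pP i) (pP j))/pI.
exists [fset q i | i in 'I_#|` P|]%fset; split.
  by move=> _ /imfsetP[/= i _ ->]; apply: gS.
split; first by rewrite card_imfset//= size_enum_ord.
right; exists [fset h x | x in P]%fset, (l * m0), (h \o p), q; split=> //.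
- by exists l, v.
- exact: min_dist_homothety.
- split; first exact: inj_comp.
  apply/fsetP => x; apply/imfsetP/imfsetP => /= -[].
    by move=> y /Pp[i ->] ->; exists i.
  by move=> i _ ->; exists (p i).
- move=> i; apply: le_trans (ltW small).
  by apply: edist_le_sup => [|j]; [exact: ltW | exact: near].
Qed.

(** A cell of side [s] is too small for two points of [S]. Each further scale splits a cell into
    [M.+1 ^ d] subcells, one of them empty. Counting duplicate-free lists [F] avoids assuming that
    [S] is finite. *)
Lemma size_avoiding (R : realType) (d M : nat) (S : set 'rV[R]_d)
    (s : R) (j : nat) (a : 'rV[R]_d) (F : seq 'rV[R]_d) :
  0 < s ->
  (forall x y, S x -> S y -> x <> y -> Num.sqrt d%:R * s < edist x y) ->
  (forall a t, 0 < t -> exists k : {ffun 'I_d -> 'I_M.+1},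
    forall x, S x -> ~ cell (subcorner a t k) t x) ->
  uniq F -> (forall x, x \in F -> S x /\ cell a (M.+1%:R ^+ j * s) x) ->
  (size F <= (M.+1 ^ d).-1 ^ j)%N.
Proof.
move=> s0 sep gap; elim: j => [|j IHj] in a F *; move=> Fu FS.
  case: F => [|x [|y F]] in Fu FS * => //; exfalso.
  have [|Sx ax] := FS x; first by rewrite inE eqxx.
  have [|Sy ay] := FS y; first by rewrite !inE eqxx orbT.
  have xy : x <> y by move=> e; move: Fu; rewrite /= e inE eqxx.
  rewrite expr0 mul1r in ax ay.
  have := sep _ _ Sx Sy xy; rewrite ltNge edist_le_sup ?(ltW s0)//.
  exact: cell_dist ax ay.
set t := M.+1%:R ^+ j * s.
have t0 : 0 < t by rewrite mulr_gt0// exprn_gt0.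
have [k0 k0P] := gap a t t0.
pose f := subindex M a t.
have Fcell x : x \in F -> cell (subcorner a t (f x)) t x.
  by move=> /FS[_]; rewrite exprS -mulrA => ?; apply: cell_subindex.
(* Sort the points of [F] by subcell; the class of the empty subcell [k0] contributes nothing. *)
rewrite -sum1_size (partition_big f predT)//= (bigD1 k0)//=.
rewrite big_seq_cond big1 ?add0n; last first.
  move=> x /andP[xF /eqP fx]; exfalso; apply: (k0P x).
    by have [] := FS x xF.
  by rewrite -fx; apply: Fcell.
apply: (@leq_trans (\sum_(k : {ffun 'I_d -> 'I_M.+1} | k != k0)
    (M.+1 ^ d).-1 ^ j)%N).
  apply: leq_sum => k _; rewrite sum1_count -size_filter.
  apply: (IHj (subcorner a t k)); first exact: filter_uniq.
  move=> x; rewrite mem_filter => /andP[/eqP <- xF].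
  by split; [have [] := FS x xF | exact: Fcell].
rewrite sum_nat_const expnS.
suff -> : #|[pred k : {ffun 'I_d -> 'I_M.+1} | k != k0]| = (M.+1 ^ d).-1 by [].
by rewrite cardC1 card_ffun !card_ord.
Qed.

(** Bernoulli's inequality [(1 + 1/a)^j >= 1 + j/a] with denominators cleared; it makes the decay of
    [(a / a.+1)^j] explicit. *)
Lemma bernoulli_expn (a j : nat) : (a ^ j * (a + j) <= a * a.+1 ^ j)%N.
Proof.
elim: j => [|j IHj]; first by rewrite !expn0; lia.
have := leq_mul (leqnn a.+1) IHj.
rewrite !expnS; move: (a ^ j)%N (a.+1 ^ j)%N => u v; nia.
Qed.

Lemma card_ge_seq (T : choiceType) (S : set T) (n : nat) :
  (`I_n #<= S)%card ->
  exists F : seq T, [/\ uniq F, size F = n & forall x, x \in F -> S x].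
Proof.
move=> /card_leP[f].
pose lift (i : 'I_n) : `I_n := SigSub (@mem_set _ `I_n i (ltn_ord i)).
exists [seq val (f (lift i)) | i : 'I_n]; split.
- rewrite map_inj_uniq ?enum_uniq// => i j /val_inj/inj e.
  by apply: val_inj; apply: (congr1 val (e _ _)); rewrite inE.
- by rewrite size_map size_enum_ord.
- by move=> _ /mapP[i _ ->]; apply: set_valP.
Qed.

Theorem theorem8 (R : realType) (d : nat) (hd : (0 < d)%N)
    (P : {fset 'rV[R]_d}) (hP : P <> fset0)
    (c delta eps : R) (hc : 0 < c) (hdelta : 0 < delta)
    (heps : 0 < eps <= 1 / 3%:R) :
  exists Z0 : R, 0 < Z0 /\
    forall (L : R) (S : set 'rV[R]_d),
      Z0 <= L ->
      separated delta S ->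
      S `<=` cube L ->
      has_at_least S (c * L ^+ d) ->
      exists Q : {fset 'rV[R]_d},
        [set` Q] `<=` S /\ approx_homothetic_copy eps P Q.
Proof.
have P0 : (0 < #|` P|)%N by rewrite cardfs_gt0; apply/eqP.
have [P1|P1] := eqVneq #|` P| 1%N.
  (* For a one-point pattern any point of [S] will do, and [S] is nonempty because
     [c * L ^+ d > 0]. *)
  exists 1; split=> // L S L1 _ _ [n Ln /card_ge_seq[F [Fu Fn FS]]].
  have n0 : (0 < n)%N.
    rewrite -(ltr_nat R); apply: lt_le_trans Ln.
    by rewrite mulr_gt0// exprn_gt0//; apply: lt_le_trans L1.
  case: F => [|y F] in Fu Fn FS; first by rewrite -Fn in n0.
  exists [fset y]%fset; split; last by split; [rewrite cardfs1 P1 | left].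
  by move=> x /=; rewrite inE => /eqP ->; apply: FS; rewrite inE eqxx.
have {P0}P1 : (1 < #|` P|)%N by rewrite ltn_neqAle eq_sym P1.
have [M M0 copyP] := copy_in_full_grid P1 heps.
(* Chosen so that [sqrt d * s < delta]: a cell of side [s] holds at most one point of [S]. *)
pose s := delta / (Num.sqrt d%:R + 1).
have r0 : 0 < Num.sqrt d%:R + 1 :> R by rewrite ltr_wpDl// sqrtr_ge0.
have s0 : 0 < s by rewrite divr_gt0.
have s_delta : Num.sqrt d%:R * s < delta.
  have -> : delta = (Num.sqrt d%:R + 1) * s by rewrite mulrC divfK// gt_eqF.
  by rewrite ltr_pM2r// ltrDl.
pose N := (M.+1 ^ d)%N.
have N1 : (1 < N)%N by rewrite -(exp1n d) ltn_exp2r.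
(* The final estimate will read [c * s ^+ d * (N.-1 + j.+1) <= N * N.-1]; this [J] makes it fail for
   all [j >= J]. *)
pose J := (Num.truncn ((N * N.-1)%:R / (c * s ^+ d))).+1.
have csd0 : 0 < c * s ^+ d by rewrite mulr_gt0// exprn_gt0.
have JP : (N * N.-1)%:R < J%:R * (c * s ^+ d).
  by rewrite -ltr_pdivrMr//; apply: truncnS_gt.
exists (M.+1%:R ^+ J * s); split; first by rewrite mulr_gt0// exprn_gt0.
move=> L S LJ sepS SL [n Ln /card_ge_seq[F [Fu Fn FS]]].
apply: contrapT => nocopy.
(* The lower bound on [L] feeds the density hypothesis; the strict upper bound puts the closed cube
   inside a half-open cell of the next scale. *)
have [j [jL Lj]] : exists j, M.+1%:R ^+ j * s <= L /\ L < M.+1%:R ^+ j.+1 * s.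
  have exj : exists j, L < M.+1%:R ^+ j * s.
    exists (Num.truncn (L / s)).+1; rewrite -ltr_pdivrMr//.
    apply: lt_le_trans (truncnS_gt _) _.
    by rewrite -natrX ler_nat ltnW// ltn_expl.
  case: (ex_minnP exj) => -[|i] Li mini.
    move: LJ; rewrite leNgt (lt_le_trans Li)// ler_pM2r// expr0.
    by rewrite -natrX ler1n expn_gt0.
  exists i; split=> //; rewrite leNgt; apply/negP => /mini.
  by rewrite ltnn.
have Jj : (J <= j)%N.
  rewrite leqNgt; apply/negP => jJ; move: Lj; apply/negP; rewrite -leNgt.
  apply: le_trans LJ; rewrite ler_pM2r// -!natrX ler_nat.
  by rewrite leq_exp2l.
have nj : (n <= N.-1 ^ j.+1)%N.
  rewrite -Fn.
  apply: (@size_avoiding R d M S s j.+1 0) => //.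
  - by move=> x y Sx Sy xy; apply: lt_le_trans (sepS _ _ Sx Sy xy).
  - move=> a t t0; apply: contrapT => full; apply: nocopy.
    apply: (copyP S a t t0) => k; apply: contrapT => nok.
    by apply: full; exists k => x Sx kx; apply: nok; exists x.
  - move=> x /FS Sx; split=> // i; have /andP[? ?] := SL _ Sx i.
    by rewrite !mxE add0r; apply/andP; split=> //; apply: le_lt_trans Lj.
(* Since [N ^ j] is the [d]-th power of [M.+1 ^ j], the left side is [c] times the volume of a cube
   of side [M.+1 ^ j * s <= L]. *)
have cN : c * s ^+ d * (N ^ j)%:R <= n%:R.
  apply: le_trans Ln; rewrite -mulrA ler_pM2l// /N -expnM mulnC expnM natrX.
  rewrite natrX -exprMn mulrC lerXn2r ?nnegrE//.
  - by rewrite mulr_ge0// ?exprn_ge0// ltW.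
  - by apply: le_trans jL; rewrite mulr_ge0// ?exprn_ge0// ltW.
(* Bernoulli with [a = N.-1] turns the bound [N.-1 ^ j.+1] on [n] into one comparable with [N ^ j];
   cancelling [N ^ j] against [cN] leaves a bound on [j]. *)
have : (n * (N.-1 + j.+1) <= N.-1 * N ^ j.+1)%N.
  have := bernoulli_expn N.-1 j.+1; rewrite prednK ?(ltnW N1)//.
  by apply: leq_trans; rewrite leq_mul2r nj orbT.
rewrite expnS mulnA (mulnC N.-1) -(ler_nat R) !natrM => bound.
have Nj0 : 0 < (N ^ j)%:R :> R by rewrite ltr0n expn_gt0 (ltnW N1).
have : c * s ^+ d * (N.-1 + j.+1)%:R <= N%:R * N.-1%:R.
  rewrite -(ler_pM2r Nj0); apply: le_trans bound.
  by rewrite mulrAC ler_wpM2r.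
apply/negP; rewrite -ltNge -natrM; apply: lt_le_trans JP _.
by rewrite mulrC ler_pM2l// ler_nat (leq_trans Jj)// addnS ltnW// ltnS leq_addl.
Qed.
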